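(* Let $N\in\mathbb{Z}_+$, $\bar a_k,\bar b_k\in\mathbb{R}$, $\bar q_k>0$, $\bar r_k>0$ for $k\in\{0,\dots,N-1\}$, $\bar q_N>0$, and let $\bar x_0\in\mathbb{R}$ be given. Consider the problem of minimizing $$L(\bar x_0,\bar u)=\bar q_N\bar x_N^4+\sum_{k=0}^{N-1}\left(\bar q_k\bar x_k^4+\bar r_k\bar u_k^4\right)$$ over admissible controls $\bar u=(\bar u_k)_{k\in\{0,\dots,N-1\}}$, subject to $$\bar x_{k+1}=\bar a_k\bar x_k+\bar b_k\bar u_k,\qquad k\in\{0,\dots,N-1\}.$$ Then the optimal control input is $$\bar u_k^*=-\frac{\left(\frac{\bar\alpha_{k+1}\bar b_k}{\bar r_k}\right)^{1/3}\bar a_k}{1+\left(\frac{\bar\alpha_{k+1}\bar b_k}{\bar r_k}\right)^{1/3}\bar b_k}\,\bar x_k,\qquad k\in\{0,\dots,N-1\},$$ where $\bar\alpha$ solves the backward recursive equation $$\bar\alpha_k=\bar q_k+\bar r_k\left(\frac{\left(\frac{\bar\alpha_{k+1}\bar b_k}{\bar r_k}\right)^{1/3}\bar a_k}{1+\left(\frac{\bar\alpha_{k+1}\bar b_k}{\bar r_k}\right)^{1/3}\bar b_k}\right)^4+\bar\alpha_{k+1}\left(\bar a_k-\frac{\left(\frac{\bar\alpha_{k+1}\bar b_k}{\bar r_k}\right)^{1/3}\bar a_k\bar b_k}{1+\left(\frac{\bar\alpha_{k+1}\bar b_k}{\bar r_k}\right)^{1/3}\bar b_k}\right)^4,\quad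 k\in\{0,\dots,N-1\},$$ with terminal condition $\bar\alpha_N=\bar q_N$.
   Context: All quantities are real and $(\cdot)^{1/3}$ denotes the real cube root (defined also for negative arguments). Admissible controls are sequences $(\bar u_k)_{k\in\{0,\dots,N-1\}}$ of real-valued Lebesgue measurable controls (with $\bar u_k^4<+\infty$), restricted to state-feedback form $\bar u_k=\bar u_k(\bar x_k)$, i.e. $\bar u_k$ is a function of the current state $\bar x_k$ only. ''Optimal'' means attaining the minimum of the cost over admissible controls. *)

(* Defs.v *)
From mathcomp Require Import all_boot all_order all_algebra.
From mathcomp Require Import all_classical all_reals all_analysis.

Set Implicit Arguments.
Unset Strict Implicit.
Unset Printing Implicit Defensive.

Import Order.TTheory GRing.Theory Num.Theory.
Import numFieldNormedType.Exports.

Local Open Scope classical_set_scope.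
Local Open Scope ring_scope.

(* [`^] only extends the real power to nonnegative bases, hence the sign. *)
Definition cbrt {R : realType} (x : R) : R := Num.sg x * `|x| `^ 3^-1.

Lemma cbrtK {R : realType} (x : R) : cbrt x ^+ 3 = x.
Proof.
rewrite /cbrt exprMn -[X in _ * X]powR_mulrn ?powR_ge0// -powRrM.
rewrite mulVf ?pnatr_eq0// powRr1// exprSr sqr_sg.
have [->|x0] := eqVneq x 0; first by rewrite normr0 mulr0.
by rewrite mul1r -numEsg.
Qed.

(* The domain carries the Lebesgue (Caratheodory) sigma-algebra, i.e. the one
   on which [completed_lebesgue_measure] is defined, not the Borel one; the
   codomain carries the Borel sigma-algebra. *)
Definition lebesgue_measurable_fun {R : realType} (f : R -> R) : Prop :=
  measurable_fun (setT : set (caratheodory_type (wlength (R := R) idfun)^*%mu))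
    (f : caratheodory_type (wlength (R := R) idfun)^*%mu -> measurableTypeR R).

(* A control is a family of feedback maps: [u k x] is the input applied at time
   [k] in state [x]. Being real-valued, it satisfies [(u k x) ^+ 4 < +oo]. *)
Definition admissible {R : realType} (N : nat) (u : nat -> R -> R) : Prop :=
  forall k, (k < N)%N -> lebesgue_measurable_fun (u k).

Fixpoint state {R : realType} (a b : nat -> R) (x0 : R) (u : nat -> R -> R)
    (k : nat) : R :=
  if k is j.+1 then
    a j * state a b x0 u j + b j * u j (state a b x0 u j)
  else x0.

Definition cost {R : realType} (N : nat) (a b q r : nat -> R) (x0 : R)
    (u : nat -> R -> R) : R :=
  let x := state a b x0 u in
  q N * x N ^+ 4
  + \sum_(0 <= k < N) (q k * x k ^+ 4 + r k * u k (x k) ^+ 4).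

Definition optimal {R : realType} (N : nat) (a b q r : nat -> R) (x0 : R)
    (u : nat -> R -> R) : Prop :=
  admissible N u /\
  forall v, admissible N v -> cost N a b q r x0 u <= cost N a b q r x0 v.

(* Main.v *)
Require Import Defs.
From mathcomp Require Import all_boot all_order all_algebra.
From mathcomp Require Import all_classical all_reals all_analysis.
From mathcomp Require Import measurable_realfun ring.
Import Order.TTheory GRing.Theory Num.Theory.
Local Open Scope ring_scope.

(** The proof is dynamic programming with the value function
    [x |-> alpha k * x ^+ 4]. The heart is the Bellman equation: for every state
    [x], the minimum over [v] of
      [q k * x ^+ 4 + r k * v ^+ 4 + alpha k.+1 * (a k * x + b k * v) ^+ 4]
    is [alpha k * x ^+ 4], attained at [v = ustar k x] and nowhere else
    ([bellman_quartic]). In [v] this is a positive combination of fourth powers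
    of affine functions, so a critical point is its unique minimizer
    ([stage_cost_leif]); the cube root appears on solving the critical point
    equation
      [r k * v ^+ 3 + alpha k.+1 * b k * (a k * x + b k * v) ^+ 3 = 0],
    which says that [v] is [- cbrt (alpha k.+1 * b k / r k)] times the next
    state.

    Telescoping the value function along a trajectory writes the cost of any
    control as [alpha 0 * x0 ^+ 4] plus a sum of nonnegative Bellman gaps
    ([cost_telescope], [cost_verification]). So [alpha 0 * x0 ^+ 4] is a lower
    bound of the cost, and it is attained exactly when every gap vanishes, that
    is, when the control agrees with [ustar] along its own trajectory. This
    gives optimality and uniqueness together. *)

(** [y ^+ 4] lies above its tangent line, and touches it only at the point of
    tangency: the difference has [(y - z) ^+ 2] as a factor, and the cofactor
    is a sum of squares. *)
Lemma quartic_tangent_leif (R : realDomainType) (y z : R) :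
  z ^+ 4 + 4 * z ^+ 3 * (y - z) <= y ^+ 4 ?= iff (y == z).
Proof.
have gapE : y ^+ 4 - (z ^+ 4 + 4 * z ^+ 3 * (y - z))
            = (y - z) ^+ 2 * ((y + z) ^+ 2 + 2 * z ^+ 2) by ring.
have z2_ge0 : 0 <= 2 * z ^+ 2 by rewrite mulr_ge0 ?sqr_ge0.
split; first by rewrite -subr_ge0 gapE mulr_ge0 ?sqr_ge0// addr_ge0 ?sqr_ge0.
rewrite eq_sym -subr_eq0 gapE mulf_eq0 sqrf_eq0 subr_eq0.
have [//|/negPf yz] := eqVneq y z.
rewrite /= paddr_eq0 ?sqr_ge0// [2 * _ == 0]mulf_eq0 pnatr_eq0 /= !sqrf_eq0.
apply/negP => /andP[/eqP yz0 /eqP z0].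
by move: yz0 yz; rewrite z0 addr0 => ->; rewrite eqxx.
Qed.

(** At a critical point [v0] the tangent lines of the two fourth powers have
    opposite slopes in [v], so adding the two tangent inequalities leaves a
    constant lower bound. Strictness comes from the first term alone. *)
Lemma stage_cost_leif (R : realDomainType) (r p b d v0 v : R) :
  0 < r -> 0 <= p -> r * v0 ^+ 3 + p * b * (d + b * v0) ^+ 3 = 0 ->
  r * v0 ^+ 4 + p * (d + b * v0) ^+ 4 <= r * v ^+ 4 + p * (d + b * v) ^+ 4
    ?= iff (v == v0).
Proof.
move=> r0 p0 crit.
have [tv tvE] := quartic_tangent_leif R v v0.
have [tw _] := quartic_tangent_leif R (d + b * v) (d + b * v0).
have tangentsE : r * v0 ^+ 4 + p * (d + b * v0) ^+ 4
    = r * (v0 ^+ 4 + 4 * v0 ^+ 3 * (v - v0))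
      + p * ((d + b * v0) ^+ 4
             + 4 * (d + b * v0) ^+ 3 * (d + b * v - (d + b * v0))).
  have : 4 * (v - v0) * (r * v0 ^+ 3 + p * b * (d + b * v0) ^+ 3) = 0.
    by rewrite crit mulr0.
  by move=> slope0; rewrite -[LHS]addr0 -slope0; ring.
split; first by rewrite tangentsE lerD ?ler_wpM2l ?(ltW r0).
apply/idP/idP => [/eqP costE|/eqP ->//].
rewrite -tvE eq_le tv /= -(ler_pM2l r0) -(lerD2r (p * (d + b * v) ^+ 4)).
by rewrite -costE tangentsE lerD2l ler_wpM2l.
Qed.

(** The cube root of [p * b / r] never has the sign opposite to [b], because
    [p] and [r] are nonnegative; this keeps the denominator
    [1 + cbrt (p * b / r) * b] of the feedback gain away from zero. *)
Lemma cbrt_mul_ge0 (R : realType) (p b r : R) :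
  0 <= p -> 0 <= r -> 0 <= cbrt (p * b / r) * b.
Proof.
move=> p0 r0; rewrite /cbrt mulrAC mulr_ge0 ?powR_ge0//.
have [b0|b0] := leP 0 b.
  by rewrite mulr_ge0// sgr_ge0 divr_ge0// mulr_ge0.
have pb_le0 : p * b <= 0 by rewrite mulr_ge0_le0 ?(ltW b0).
by rewrite mulr_le0 ?(ltW b0) ?sgr_le0 ?(mulr_le0_ge0 pb_le0) ?invr_ge0.
Qed.

(** With [c = cbrt (p * b / r)], the control [v0 = - g * x] is the solution of
    [v0 = - c * (a * x + b * v0)], and it leads to the state
    [a * x / (1 + c * b)]. Cubing the relation and using [r * c ^+ 3 = p * b]
    gives the critical point equation. *)
Lemma bellman_quartic (R : realType) (a b q r p x v : R) :
  0 < r -> 0 <= p ->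
  let g := cbrt (p * b / r) * a / (1 + cbrt (p * b / r) * b) in
  let g' := cbrt (p * b / r) * a * b / (1 + cbrt (p * b / r) * b) in
  (q + r * g ^+ 4 + p * (a - g') ^+ 4) * x ^+ 4
    <= q * x ^+ 4 + r * v ^+ 4 + p * (a * x + b * v) ^+ 4
    ?= iff (v == - g * x).
Proof.
move=> r0 p0.
have := cbrt_mul_ge0 R p b r p0 (ltW r0); have := cbrtK (p * b / r).
set c := cbrt _ => c3 cb0 g g'.
have den0 : 1 + c * b != 0 by rewrite gt_eqF // ltr_pwDl.
have rc3 : p * b = r * c ^+ 3 by rewrite c3 [r * _]mulrC divfK // gt_eqF.
have nextE : a * x + b * (- g * x) = a * x / (1 + c * b) by rewrite /g; field.
have crit : r * (- g * x) ^+ 3 + p * b * (a * x + b * (- g * x)) ^+ 3 = 0.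
  by rewrite nextE rc3 /g; field.
have valueE : (q + r * g ^+ 4 + p * (a - g') ^+ 4) * x ^+ 4
    = q * x ^+ 4 + (r * (- g * x) ^+ 4 + p * (a * x + b * (- g * x)) ^+ 4).
  by rewrite /g' /g; field.
rewrite valueE -addrA.
have [le_cost eq_cost] := stage_cost_leif R r p b (a * x) (- g * x) v r0 p0 crit.
by split; [rewrite lerD2l | rewrite (inj_eq (addrI _))].
Qed.

Lemma cost_telescope (R : realType) (N : nat) (a b q r : nat -> R) (x0 : R)
    (alpha : nat -> R) (u : nat -> R -> R) :
  alpha N = q N ->
  let x := state a b x0 u in
  cost N a b q r x0 u - alpha 0%N * x0 ^+ 4
  = \sum_(0 <= k < N) (q k * x k ^+ 4 + r k * u k (x k) ^+ 4
       + alpha k.+1 * x k.+1 ^+ 4 - alpha k * x k ^+ 4).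
Proof.
move=> alphaN x.
under [RHS]eq_bigr do rewrite -addrA.
rewrite big_split telescope_sumr //= /cost -/x alphaN.
by rewrite addrAC addrC.
Qed.

(** The verification theorem of dynamic programming, with its equality case:
    every summand in [cost_telescope] is nonnegative by the Bellman inequality
    at the visited state, so the sum vanishes only if each of them does. *)
Lemma cost_verification (R : realType) (N : nat) (a b q r : nat -> R) (x0 : R)
    (alpha : nat -> R) (w : nat -> R -> R) (u : nat -> R -> R) :
  alpha N = q N ->
  (forall k, (k < N)%N -> forall x v : R,
     alpha k * x ^+ 4 <=
       q k * x ^+ 4 + r k * v ^+ 4 + alpha k.+1 * (a k * x + b k * v) ^+ 4
       ?= iff (v == w k x)) ->
  alpha 0%N * x0 ^+ 4 <= cost N a b q r x0 u
    ?= iff [forall k : 'I_N,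
              u k (state a b x0 u k) == w k (state a b x0 u k)].
Proof.
move=> alphaN bellman; set x := state a b x0 u.
have [gap_ge0 gap_eq0] : 0 <= cost N a b q r x0 u - alpha 0%N * x0 ^+ 4
    ?= iff [forall k : 'I_N, u k (x k) == w k (x k)].
  have zero_sum : 0 = \sum_(k < N) 0 :> R by rewrite big1_eq.
  rewrite cost_telescope// big_mkord {1}zero_sum.
  apply: leif_sum => k _.
  have [le_k eq_k] := bellman k (ltn_ord k) (x k) (u k (x k)).
  by split; [rewrite subr_ge0 | rewrite eq_sym subr_eq0 eq_sym].
split; first by rewrite -subr_ge0.
by rewrite -gap_eq0 [RHS]eq_sym subr_eq0 eq_sym.
Qed.

(** Positivity of [alpha] makes the stage cost convex in the control and rules
    out a vanishing denominator in the feedback gain. It propagates backward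
    because the gains enter the recursion only through even powers. *)
Lemma riccati_gt0 (R : realType) (N : nat) (q r alpha : nat -> R)
    (g h : nat -> R) :
  (forall k, (k < N)%N -> 0 < q k) -> (forall k, (k < N)%N -> 0 < r k) ->
  0 < alpha N ->
  (forall k, (k < N)%N ->
     alpha k = q k + r k * g k ^+ 4 + alpha k.+1 * h k ^+ 4) ->
  forall k, (k <= N)%N -> 0 < alpha k.
Proof.
move=> q0 r0 alphaN rec k kN; rewrite -(subKn kN).
elim: (N - k)%N (leq_subr k N) => [|m IH] mN; first by rewrite subn0.
have kN' : (N - m.+1 < N)%N by rewrite ltn_subrL (leq_trans _ mN).
have even4 : ~~ odd 4 by [].
rewrite rec// -addrA ltr_pwDl ?q0// addr_ge0// mulr_ge0 ?exprn_even_ge0//.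
  by rewrite ltW ?r0.
by rewrite subnSK// ltW// IH// ltnW.
Qed.

(** Linear maps are Borel measurable, and Borel sets are among the
    Caratheodory measurable sets. *)
Lemma lebesgue_measurable_linear (R : realType) (g : R) :
  lebesgue_measurable_fun (fun x : R => g * x).
Proof.
move=> _ B mB; apply: sub_caratheodory.
exact: (@mulrl_measurable R setT g measurableT B mB).
Qed.

Theorem proposition1 (R : realType) (N : nat) (a b q r : nat -> R) (x0 : R)
    (hq : forall k, (k < N)%N -> 0 < q k)
    (hr : forall k, (k < N)%N -> 0 < r k)
    (hqN : 0 < q N)
    (alpha : nat -> R)
    (halphaN : alpha N = q N)
    (halpha : forall k, (k < N)%N ->
      alpha k =
        q k
        + r k * (cbrt (alpha k.+1 * b k / r k) * a k
                 / (1 + cbrt (alpha k.+1 * b k / r k) * b k)) ^+ 4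
        + alpha k.+1
          * (a k - cbrt (alpha k.+1 * b k / r k) * a k * b k
                   / (1 + cbrt (alpha k.+1 * b k / r k) * b k)) ^+ 4) :
  let ustar : nat -> R -> R := fun k x =>
    - (cbrt (alpha k.+1 * b k / r k) * a k
       / (1 + cbrt (alpha k.+1 * b k / r k) * b k)) * x in
  optimal N a b q r x0 ustar
  /\ (forall u, optimal N a b q r x0 u ->
        forall k, (k < N)%N ->
          u k (state a b x0 u k) = ustar k (state a b x0 u k)).
Proof.
move=> ustar.
have alpha_gt0 : forall k, (k <= N)%N -> 0 < alpha k.
  by apply: (riccati_gt0 R N q r alpha _ _ hq hr _ halpha); rewrite halphaN.
(* [halpha] turns the left-hand side of the Bellman inequality into
   [alpha k * x ^+ 4]. *)
have cost_leif u := cost_verification R N a b q r x0 alpha ustar u halphaN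
  (fun k kN x v => eq_ind_r (fun y => y * x ^+ 4 <= _ ?= iff _)
     (bellman_quartic R (a k) (b k) (q k) (r k) (alpha k.+1) x v
        (hr k kN) (ltW (alpha_gt0 k.+1 kN))) (halpha k kN)).
have costE : alpha 0%N * x0 ^+ 4 = cost N a b q r x0 ustar.
  by apply/eqP; rewrite (cost_leif ustar).2; apply/forallP => k.
have ustar_adm : admissible N ustar.
  by move=> k _; exact: lebesgue_measurable_linear.
split.
  by split=> // v _; rewrite -costE (cost_leif v).1.
move=> u [_ u_min] k kN.
have : alpha 0%N * x0 ^+ 4 == cost N a b q r x0 u.
  by rewrite eq_le (cost_leif u).1 costE u_min.
by rewrite (cost_leif u).2 => /forallP/(_ (Ordinal kN))/eqP.
Qed.
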